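(* Let $\mu$ be an arbitrary Borel probability measure on $\mathbb T$, let $m>0$, let $0<q\le\frac12$, and define $$\rho(s)=m\int_{\mathbb T}\mathcal P_q(s-\theta)\,d\mu(\theta).$$ Then $\rho$ is smooth and positive and satisfies $$2I_1+I_2\ge0.$$ The inequality is strict unless $\rho$ is constant. (The measure $\mu$ may have arbitrary finite or infinite support and may be continuous or singular.)
   Context: $\mathbb T=\mathbb R/2\pi\mathbb Z$, $\rho_s$ is the derivative of $\rho$, and $\Lambda$ is the Fourier multiplier $\widehat{\Lambda f}(k)=|k|\hat f(k)$. The Poisson kernel is $$\mathcal P_q(s)=\frac{1-q^2}{1-2q\cos s+q^2}=1+2\sum_{n\ge1}q^n\cos(ns).$$ For smooth $\rho$, $$I_1=\int_{\mathbb T}\rho(\Lambda\rho_s)\rho_s\,ds,\qquad I_2=\int_{\mathbb T}(\Lambda\rho)\rho_s^2\,ds.$$ *)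

(* Defs.v *)
From mathcomp Require Import all_boot all_order all_algebra.
From mathcomp Require Import generic_quotient.
From mathcomp Require Import all_classical all_reals all_analysis.
From mathcomp Require Import complex.

Set Implicit Arguments.
Unset Strict Implicit.
Unset Printing Implicit Defensive.

Import Order.TTheory GRing.Theory Num.Theory.
Import numFieldNormedType.Exports.

Local Open Scope classical_set_scope.
Local Open Scope ring_scope.

Section torus.
Variable R : realType.

Definition eq_mod2pi (x y : R) : bool :=
  `[< exists k : int, x - y = k%:~R * (2 * pi) >].

Lemma eq_mod2pi_refl : reflexive eq_mod2pi.
Proof. by move=> x; apply/asboolP; exists 0; rewrite subrr mul0r. Qed.

Lemma eq_mod2pi_sym : symmetric eq_mod2pi.
Proof.
suff sub x y : eq_mod2pi x y -> eq_mod2pi y x by move=> x y; apply/idP/idP; exact: sub.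
move=> /asboolP[k kE]; apply/asboolP; exists (- k).
by rewrite -opprB kE mulrNz mulNr.
Qed.

Lemma eq_mod2pi_trans : transitive eq_mod2pi.
Proof.
move=> y x z /asboolP[k kE] /asboolP[l lE]; apply/asboolP; exists (k + l).
by rewrite intrD mulrDl -kE -lE addrA subrK.
Qed.

Canonical eq_mod2pi_equiv :=
  EquivRel eq_mod2pi eq_mod2pi_refl eq_mod2pi_sym eq_mod2pi_trans.

(* The circle R / 2 pi Z, with the quotient topology. *)
Definition torus : Type := quotient_topology {eq_quot eq_mod2pi}%qT.

(* The circle with its Borel sigma-algebra. *)
Definition borel_torus : Type := g_sigma_algebraType (@open torus).

End torus.

(* Functions on the circle are represented by 2 pi-periodic functions on R. *)
Section functions_on_the_torus.
Variable R : realType.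
Implicit Types (f : R -> R) (s : R) (k : int).

Definition smooth_on_torus f : Prop :=
  periodic f (2 * pi) /\ forall (n : nat) (s : R), derivable (f^`(n))%classic s 1.

Definition torus_integral f : R :=
  \int[lebesgue_measure]_(s in `[0, 2 * pi]) f s.

Local Open Scope complex_scope.

Definition expi (t : R) : R[i] := cos t +i* sin t.

(* (2 pi)^-1 * \int_T f(s) exp(- i k s) ds, split into real and imaginary
   parts *)
Definition fourier_coef f k : R[i] :=
  ((2 * pi)^-1 * torus_integral (fun s => f s * cos (k%:~R * s)))
  -i* ((2 * pi)^-1 * torus_integral (fun s => f s * sin (k%:~R * s))).

(* The sum over - n <= k <= n of a(k) f^(k) exp(i k s) *)
Definition multiplier_partial_sum (a : int -> R) f s (n : nat) : R[i] :=
  \sum_(j < n.*2.+1)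
    let k := j%:Z - n%:Z in (a k)%:C * fourier_coef f k * expi (k%:~R * s).

(* For an even real symbol and a real f the partial sums are real, so taking
   the real part only changes the type. *)
Definition fourier_multiplier (a : int -> R) f s : R :=
  limn (fun n => complex.Re (multiplier_partial_sum a f s n)).

(* The operator with Fourier coefficients |k| f^(k), as the sum of its Fourier
   series; the series converges for smooth f, outside of that [limn] may be
   a default value. *)
Definition Lambda : (R -> R) -> R -> R :=
  fourier_multiplier (fun k => `|k%:~R|).

Definition I1 f : R :=
  torus_integral (fun s => f s * Lambda f^`()%classic s * f^`()%classic s).

Definition I2 f : R :=
  torus_integral (fun s => Lambda f s * f^`()%classic s ^+ 2).

Definition poisson_kernel (q s : R) : R :=
  (1 - q ^+ 2) / (1 - 2 * q * cos s + q ^+ 2).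

(* The kernel is 2 pi-periodic, so the value does not depend on the
   representative of the point theta of the circle. *)
Definition poisson_integral (q : R) (mu : probability (borel_torus R) R) (s : R) : R :=
  \int[mu]_theta poisson_kernel q (s - repr (theta : torus R)).

End functions_on_the_torus.

(* Main.v *)
Require Import Defs.
From mathcomp Require Import all_boot all_order all_algebra.
From mathcomp Require Import all_classical all_reals all_analysis.
From mathcomp Require Import measurable_realfun.
From mathcomp Require Import complex.
From mathcomp Require Import ring lra zify.

(** Write rho as the sum of u_k exp (i k s), with u_k = m q^|k| mu_k and mu_k the
    Fourier moments of the measure mu. The coefficients decay exponentially, so rho
    is smooth, its derivatives and its image under Lambda have the expected
    coefficients, and integrals of triple products are limits of finite sums over
    triples of frequencies with a + b + c = 0.

    In these terms 2 I1 + I2 is 2 pi times the sum of u_a u_b u_c w(a, b, c) with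
    w(a, b, c) = - (2 |b| b c + |a| b c). Since only the symmetrization of w counts,
    w may be replaced by the weight that vanishes unless a < 0 < b and equals
    2 |a| |b| (|a| + |b|) there ([symbol_identity]). With a = - n, b = k the third
    frequency is n - k, the powers of q combine to q^(2 max(n, k)), and the form
    becomes

      2 m^3 sum_(n, k >= 1) n k (n + k) q^(2 max(n, k)) conj(mu_n) mu_k mu_(n - k).

    The last moment is the integral of exp (- i (n - k) theta) over mu. Hence this
    is an average over theta of the forms sum_(n, k) V(n, k) conj(d_n) d_k, with
    d_n = mu_n exp (i n theta) and V(n, k) = n k (n + k) q^(2 max(n, k)).

    The kernel V is positive semidefinite: it is the sum of n k h(max(n, k)) and
    n^2 k^2 h'(max(n, k)) with h(l) = l q^(2 l) and h'(l) = q^(2 l) / l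
    ([weight_split]), and both h and h' decrease to 0 because q <= 1/2, so that
    summation by parts turns the forms into sums of squares ([staircase_kernel]).
    This proves the inequality. If rho is not constant, let n be the least positive
    frequency with mu_n != 0: the square of index n is at least
    (h(n) - h(n + 1)) n^2 |mu_n|^2 > 0, whence strictness ([toeplitz_sum_gt0]). *)

Set Implicit Arguments.
Unset Strict Implicit.
Unset Printing Implicit Defensive.

Import Order.TTheory GRing.Theory Num.Theory.
Import numFieldNormedType.Exports.
Import Normc.

Local Open Scope classical_set_scope.
Local Open Scope ring_scope.

(** * Integrals of bounded measurable complex functions *)

Section bounded_measurable.
Context d (T : measurableType d) (R : realType).
Variables (mu : {measure set T -> \bar R}) (D : set T).
Implicit Types (f g : T -> R) (F G : T -> R[i]) (K : R).

(** On a set of finite measure these functions are integrable and stable under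
    products, which the integrable functions are not. *)
Definition bmeas f := measurable_fun D f /\ exists K, forall x, D x -> `|f x| <= K.

Definition cbmeas F :=
  bmeas (fun x => complex.Re (F x)) /\ bmeas (fun x => complex.Im (F x)).

Lemma bmeas_cst K : bmeas (cst K).
Proof. by split; [exact: measurable_cst|exists `|K|]. Qed.

Lemma bmeasD f g : bmeas f -> bmeas g -> bmeas (fun x => f x + g x).
Proof.
move=> [mf [K fK]] [mg [L gL]]; split; first exact: measurable_funD.
exists (K + L) => x Dx; apply: (le_trans (ler_normD _ _)).
by apply: lerD; [exact: fK|exact: gL].
Qed.

Lemma bmeasM f g : bmeas f -> bmeas g -> bmeas (fun x => f x * g x).
Proof.
move=> [mf [K fK]] [mg [L gL]]; split; first exact: measurable_funM.
exists (K * L) => x Dx; rewrite normrM.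
by apply: ler_pM => //; [exact: fK|exact: gL].
Qed.

Lemma bmeasN f : bmeas f -> bmeas (fun x => - f x).
Proof.
move=> bf; rewrite (_ : (fun _ => _) = (fun x => cst (-1) x * f x)).
  by apply: bmeasM => //; exact: bmeas_cst.
by apply/funext => x; rewrite mulN1r.
Qed.

Lemma cbmeas_cst (c : R[i]) : cbmeas (fun=> c).
Proof. by split; exact: bmeas_cst. Qed.

Lemma cbmeasD F G : cbmeas F -> cbmeas G -> cbmeas (fun x => F x + G x).
Proof.
move=> [rF iF] [rG iG]; split.
  rewrite (_ : (fun _ => _) = (fun x => complex.Re (F x) + complex.Re (G x))).
    exact: bmeasD.
  by apply/funext => x; rewrite raddfD.
rewrite (_ : (fun _ => _) = (fun x => complex.Im (F x) + complex.Im (G x))).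
  exact: bmeasD.
by apply/funext => x; rewrite raddfD.
Qed.

Lemma Re_add (a b : R[i]) : complex.Re (a + b) = complex.Re a + complex.Re b.
Proof. by case: a => ? ?; case: b. Qed.

Lemma Re_sum (I : Type) (r : seq I) (z : I -> R[i]) :
  complex.Re (\sum_(i <- r) z i) = \sum_(i <- r) complex.Re (z i).
Proof. exact: (big_morph _ Re_add). Qed.

Lemma Re_mul (a b : R[i]) : complex.Re (a * b) =
  complex.Re a * complex.Re b - complex.Im a * complex.Im b.
Proof. by case: a => ? ?; case: b. Qed.

Lemma Im_mul (a b : R[i]) : complex.Im (a * b) =
  complex.Re a * complex.Im b + complex.Im a * complex.Re b.
Proof. by case: a => ? ?; case: b. Qed.

Lemma cbmeasM F G : cbmeas F -> cbmeas G -> cbmeas (fun x => F x * G x).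
Proof.
move=> [rF iF] [rG iG]; split.
  under eq_fun do rewrite Re_mul.
  by apply: bmeasD; [|apply: bmeasN]; exact: bmeasM.
under eq_fun do rewrite Im_mul.
by apply: bmeasD; exact: bmeasM.
Qed.

Lemma cbmeas_sum (I : Type) (r : seq I) (F_ : I -> T -> R[i]) :
  (forall i, cbmeas (F_ i)) -> cbmeas (fun x => \sum_(i <- r) F_ i x).
Proof.
move=> bF; elim: r => [|i r IH].
  by under eq_fun do rewrite big_nil; exact: cbmeas_cst.
by under eq_fun do rewrite big_cons; exact: cbmeasD.
Qed.

Hypotheses (mD : measurable D) (Dfin : (mu D < +oo)%E).

Lemma bmeas_integrable f : bmeas f -> mu.-integrable D (EFin \o f).
Proof.
move=> [mf [K fK]]; apply: measurable_bounded_integrable => //.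
exists K; split; first exact: num_real.
by move=> L KL x Dx; apply: (le_trans (fK x Dx)); exact: ltW.
Qed.

(** Dominated convergence with a constant dominating function, in the form that
    also transfers measurability and the bound to the limit. *)
Lemma bounded_cvg (f_ : (T -> R)^nat) f K :
  (forall n, measurable_fun D (f_ n)) ->
  (forall n x, D x -> `|f_ n x| <= K) ->
  (forall x, D x -> f_ ^~ x @ \oo --> f x) ->
  bmeas f /\
  \int[mu]_(x in D) f_ n x @[n --> \oo] --> \int[mu]_(x in D) f x.
Proof.
move=> mf_ f_K f_f.
have mf : measurable_fun D f by exact: measurable_fun_cvg f_f.
have bf : bmeas f.
  split => //; exists K => x Dx.
  have cv : `|f_ n x| @[n --> \oo] --> `|f x| by apply: cvg_norm; exact: f_f.
  rewrite -(cvg_lim (@Rhausdorff R) cv); apply: limr_le.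
    by apply/cvg_ex; eexists; exact: cv.
  by near=> n; exact: f_K.
split => //.
have [|||||_ _ h] := @dominated_convergence _ T R mu D mD
    (fun n => EFin \o f_ n) (EFin \o f) (EFin \o cst K).
- by move=> n; exact/measurable_EFinP.
- exact/measurable_EFinP.
- apply: aeW => x Dx; apply/fine_cvgP; split; first by near=> n.
  exact: f_f.
- by apply: bmeas_integrable; exact: bmeas_cst.
- by apply: aeW => x n Dx; rewrite /= lee_fin f_K.
rewrite /Rintegral; apply: fine_cvg.
rewrite fineK//; apply: integrable_fin_num => //; exact: bmeas_integrable.
Unshelve. all: by end_near. Qed.

Definition cint F : R[i] :=
  Complex (\int[mu]_(x in D) complex.Re (F x)) (\int[mu]_(x in D) complex.Im (F x)).

Lemma cintD F G : cbmeas F -> cbmeas G ->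
  cint (fun x => F x + G x) = cint F + cint G.
Proof.
move=> [rF iF] [rG iG]; rewrite /cint.
under eq_Rintegral do rewrite raddfD.
under [X in Complex _ X]eq_Rintegral do rewrite raddfD.
by rewrite !RintegralD//; exact: bmeas_integrable.
Qed.

Lemma cintZ (c : R[i]) F : cbmeas F -> cint (fun x => c * F x) = c * cint F.
Proof.
move=> [rF iF]; rewrite /cint.
under eq_Rintegral do rewrite Re_mul.
under [X in Complex _ X]eq_Rintegral do rewrite Im_mul.
have iM f (k : R) : bmeas f -> mu.-integrable D (EFin \o (fun x => k * f x)).
  by move=> bf; apply: bmeas_integrable; apply: bmeasM => //; exact: bmeas_cst.
rewrite RintegralB//; [|exact: iM|exact: iM].
rewrite RintegralD//; [|exact: iM|exact: iM].
rewrite !RintegralZl//; try exact: bmeas_integrable.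
by case: c.
Qed.

Lemma cint_sum (I : Type) (r : seq I) (F_ : I -> T -> R[i]) :
  (forall i, cbmeas (F_ i)) ->
  cint (fun x => \sum_(i <- r) F_ i x) = \sum_(i <- r) cint (F_ i).
Proof.
move=> bF; elim: r => [|i r IH].
  rewrite big_nil /cint.
  under eq_Rintegral do rewrite big_nil.
  under [X in Complex _ X]eq_Rintegral do rewrite big_nil.
  by rewrite Rintegral_cst// mul0r.
rewrite big_cons -IH -cintD//; last exact: cbmeas_sum.
by congr cint; apply/funext => x; rewrite big_cons.
Qed.

End bounded_measurable.

(** * Symmetric trigonometric sums with exponentially decaying coefficients *)

Section trigonometric_sums.
Variable R : realType.
Implicit Types (u v w : int -> R[i]) (s h x : R) (k : int) (n N : nat).

Lemma Re_le_normc (z : R[i]) : `|complex.Re z| <= normc z.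
Proof. by case: z => a b /=; rewrite -sqrtr_sqr ler_wsqrtr// lerDl sqr_ge0. Qed.

Lemma normc_ge0 (z : R[i]) : 0 <= normc z.
Proof. by case: z => a b; exact: sqrtr_ge0. Qed.

Lemma normc_le (z : R[i]) : normc z <= `|complex.Re z| + `|complex.Im z|.
Proof.
case: z => a b /=; rewrite -[leRHS]ger0_norm ?addr_ge0// -sqrtr_sqr ler_wsqrtr//.
have := normr_ge0 a; have := normr_ge0 b; rewrite sqrrD !real_normK ?num_real//.
by move=> b0 a0; rewrite lerD2r lerDl mulrn_wge0// mulr_ge0.
Qed.

Lemma expiD x s : expi (x + s) = expi x * expi s.
Proof.
rewrite /expi cosD sinD /=; congr Complex.
by rewrite addrC mulrC [X in _ + X]mulrC.
Qed.

Lemma expi0 : expi (0 : R) = 1.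
Proof. by rewrite /expi cos0 sin0. Qed.

Lemma conj_expi s : conjc (expi s) = expi (- s).
Proof. by rewrite /expi cosN sinN. Qed.

Lemma normc_expi s : normc (expi s) = 1.
Proof. by rewrite /= cos2Dsin2 sqrtr1. Qed.

Lemma periodic_mulz (f : R -> R) (T : R) k s :
  periodic f T -> f (s + k%:~R * T) = f s.
Proof.
move=> fT; have fTn m x : f (x + m%:R * T) = f x.
  by rewrite mulr_natl; exact: periodicn.
case: k => m; first exact: fTn.
by rewrite -[LHS](fTn m.+1) NegzE mulrNz mulNr subrK.
Qed.

Lemma expi_period k s : expi (s + k%:~R * (2 * pi)) = expi s.
Proof.
rewrite /expi mulr_natl; congr Complex; apply: periodic_mulz.
  exact: cosD2pi.
exact: sinD2pi.
Qed.

(** Symmetric sums are nested: this turns statements on them into inductions on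
    the cutoff. *)
Lemma symsumS (V : zmodType) (F : int -> V) N :
  \sum_(j < N.+1.*2.+1) F (j%:Z - N.+1%:Z) =
  \sum_(j < N.*2.+1) F (j%:Z - N%:Z) + (F N.+1 + F (- N.+1%:Z)).
Proof.
rewrite -!(big_mkord xpredT (fun j => F (Posz j - _))) doubleS.
rewrite big_nat_recl// big_nat_recr//= add0r [LHS]addrC -addrA; congr (_ + _).
  by apply: eq_bigr => j _; congr F; lia.
by congr (F _ + F _); lia.
Qed.

(** The Weierstrass test in the form used below: the uniform bound is what
    bounded convergence asks of the partial sums. *)
Lemma geometric_increments (x_ : nat -> R) (K r : R) :
  0 <= K -> 0 <= r -> r < 1 ->
  (forall n, `|x_ n.+1 - x_ n| <= K * r ^+ n) ->
  cvgn x_ /\ forall n, `|x_ n| <= `|x_ 0%N| + K / (1 - r).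
Proof.
move=> K0 r0 r1 xr.
have xE n : x_ n = x_ 0%N + series (fun i => x_ i.+1 - x_ i) n.
  by rewrite /series/= telescope_sumr// subrKC.
have geo n : series (fun i => `|x_ i.+1 - x_ i|) n <= series (geometric K r) n.
  by rewrite /series/=; apply: ler_sum => i _; exact: xr.
have rn : `|r| < 1 by rewrite ger0_norm.
have geoK n : series (geometric K r) n <= K / (1 - r).
  rewrite geometric_seriesE ?lt_eqF//= ler_pM2r ?invr_gt0 ?subr_gt0//.
  by rewrite ler_piMr// gerBl exprn_ge0.
split.
  rewrite (_ : x_ = cst (x_ 0%N) \+ series (fun i => x_ i.+1 - x_ i)).
    apply: is_cvgD; first exact: is_cvg_cst.
    apply: normed_cvg; apply: series_le_cvg xr _ => //.
    - by move=> n; rewrite mulr_ge0// exprn_ge0.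
    - exact: is_cvg_geometric_series.
  by apply/funext => n; rewrite [LHS]xE.
move=> n; rewrite xE; apply: (le_trans (ler_normD _ _)).
rewrite lerD2l; apply: le_trans (geoK n).
apply: le_trans (geo n); exact: ler_norm_sum.
Qed.

(** Exponential rather than rapid decay: the class is stable under multiplication
    by k, hence under derivatives and Lambda, and all its series have geometric
    tails. *)
Definition decays u := exists C r : R, [/\ 0 <= C, 0 <= r, r < 1 &
  forall k, normc (u k) <= C * r ^+ `|k|%N].

(** Equivalently, n t^n <= 1 + t + ... + t^(n-1), as each term is at least t^n. *)
Lemma mulrn_expr_le (t : R) n : 0 <= t -> t < 1 ->
  n%:R * t ^+ n * (1 - t) <= 1 - t ^+ n.
Proof.
move=> t0 t1; elim: n => [|n IH]; first by rewrite mul0r mul0r expr0 subrr.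
have tn : 0 <= t ^+ n by exact: exprn_ge0.
have tn1 : t ^+ n <= 1 by rewrite exprn_ile1// ltW.
rewrite exprS -natr1; move: (t ^+ n) tn tn1 IH => y y0 y1; move: (n%:R : R) => m mt.
have h1 : t * (m * y * (1 - t)) <= t * (1 - y) by exact: ler_wpM2l.
have h2 : 0 <= (1 - t) * (1 - t * y).
  by rewrite mulr_ge0 ?subr_ge0 ?mulr_ile1// ltW.
by lra.
Qed.

(** The factor k is absorbed by passing from the rate r to the larger rate
    (1 + r) / 2 < 1. *)
Lemma decaysM (c : int -> R[i]) u :
  (forall k, normc (c k) <= `|k|%N%:R) -> decays u -> decays (fun k => c k * u k).
Proof.
move=> ck [C [r [C0 r0 r1 uC]]].
pose r' := (1 + r) / 2; pose t := r / r'.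
have r'0 : 0 < r' by rewrite /r'; lra.
have t0 : 0 <= t by rewrite /t divr_ge0// ltW.
have t1 : t < 1 by rewrite /t ltr_pdivrMr// /r'; lra.
exists (C / (1 - t)), r'; split.
- by rewrite divr_ge0// subr_ge0 ltW.
- exact: ltW.
- by rewrite /r'; lra.
move=> k; rewrite normcM.
apply: (@le_trans _ _ (`|k|%N%:R * (C * r ^+ `|k|%N))).
  by apply: ler_pM => //; exact: normc_ge0.
have -> : r = t * r' by rewrite /t mulfVK// gt_eqF.
clearbody t.
have := mulrn_expr_le `|k|%N t0 t1; rewrite [(t * r') ^+ _]exprMn.
have tn : 0 <= t ^+ `|k|%N by exact: exprn_ge0.
have rn : 0 <= r' ^+ `|k|%N by rewrite exprn_ge0// ltW.
move: (t ^+ _) (r' ^+ _) (`|k|%N%:R : R) tn rn => y z m y0 z0 myt.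
rewrite (_ : m * _ = C * (m * y) * z); last by ring.
apply: ler_wpM2r => //; apply: ler_wpM2l => //.
by rewrite -[leRHS]mul1r ler_pdivlMr ?subr_gt0//; lra.
Qed.

Lemma symsum_bounded (G : int -> R) (C r : R) : 0 <= C -> 0 <= r -> r < 1 ->
  (forall k, `|G k| <= C * r ^+ `|k|%N) ->
  exists K, forall N, `|\sum_(j < N.*2.+1) G (j%:Z - N%:Z)| <= K.
Proof.
move=> C0 r0 r1 GC; eexists => N.
apply: (@geometric_increments
  (fun N => \sum_(j < N.*2.+1) G (j%:Z - N%:Z)) (2 * C) r _ r0 r1 _).2.
  by rewrite mulr_ge0.
move=> n; rewrite symsumS [X in `|X|]addrC addKr.
apply: (le_trans (ler_normD _ _)).
have := GC n.+1; have := GC (- n.+1%:Z); rewrite abszN !absz_nat exprS => h1 h2.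
have : C * (r * r ^+ n) <= C * r ^+ n.
  by apply: ler_wpM2l => //; rewrite ler_piMl ?exprn_ge0// ltW.
lra.
Qed.

Definition tpoly u s N : R[i] :=
  \sum_(j < N.*2.+1) u (j%:Z - N%:Z) * expi ((j%:Z - N%:Z)%:~R * s).

Definition tser u s : R := limn (fun N => complex.Re (tpoly u s N)).

Lemma tpoly_bounded u : decays u ->
  exists K, forall N s, normc (tpoly u s N) <= K.
Proof.
move=> [C [r [C0 r0 r1 uC]]].
have [|K KP] := @symsum_bounded (fun k => normc (u k)) C r C0 r0 r1.
  by move=> k; rewrite ger0_norm ?normc_ge0.
exists K => N s; apply: le_trans (KP N); apply: le_trans (ler_norm _).
rewrite /tpoly; elim/big_ind2: _ => [||j _].
- by rewrite normc0.
- by move=> x1 y1 x2 y2 xy1 xy2; apply: (le_trans (le_normcD _ _)); exact: lerD.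
- by rewrite normcM normc_expi mulr1.
Qed.

Lemma tser_cvg u s : decays u -> complex.Re (tpoly u s n) @[n --> \oo] --> tser u s.
Proof.
move=> [C [r [C0 r0 r1 uC]]].
have C20 : 0 <= 2 * C by rewrite mulr_ge0.
have [|//] := @geometric_increments
  (fun N => complex.Re (tpoly u s N)) (2 * C) r C20 r0 r1.
move=> n; rewrite -raddfB/=; apply: (le_trans (Re_le_normc _)).
rewrite /tpoly (symsumS (fun k => u k * expi (k%:~R * s))) [X in normc X]addrC addKr.
apply: (le_trans (le_normcD _ _)); rewrite !normcM !normc_expi !mulr1.
have := uC n.+1; have := uC (- n.+1%:Z); rewrite abszN !absz_nat exprS => h1 h2.
have : C * (r * r ^+ n) <= C * r ^+ n.
  by apply: ler_wpM2l => //; rewrite ler_piMl ?exprn_ge0// ltW.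
lra.
Qed.

Lemma sin_le_norm x : `|sin x| <= `|x|.
Proof.
wlog x0 : x / 0 <= x => [H|].
  have [/H//|/ltW x0] := leP 0 x.
  by rewrite -normrN -sinN -[leRHS]normrN H// oppr_ge0.
have [c _] : exists2 c, c \in `[0, x]%R & sin x - sin 0 = cos c * (x - 0).
  apply: MVT_segment => //.
  by apply: continuous_subspaceT => y; exact: continuous_sin.
rewrite sin0 !subr0 => ->; rewrite normrM ler_piMl//; exact: cos_max.
Qed.

Lemma cosB1_le x : `|cos x - 1| <= x ^+ 2.
Proof.
have [y ->] : exists y, x = y *+ 2 by exists (x / 2); rewrite mulr2n; lra.
have := sin_le_norm y; have := cos2Dsin2 y; rewrite cos_mulr2n.
rewrite -(@ler_pXn2r _ 2)// ?nnegrE// !real_normK ?num_real// => cs sy.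
have -> : cos y ^+ 2 *+ 2 - 1 - 1 = - (2 * sin y ^+ 2) by move: cs; lra.
have := sqr_ge0 (sin y); have := sqr_ge0 y => *.
by rewrite normrN ger0_norm; lra.
Qed.

(** The order 2 of the error is what differentiation term by term uses. *)
Lemma sinBid_le x : `|sin x - x| <= 2 * x ^+ 2.
Proof.
wlog x0 : x / 0 <= x => [H|].
  have [/H//|/ltW x0] := leP 0 x.
  by have := H (- x); rewrite sinN -opprD normrN sqrrN oppr_ge0; exact.
have [c cx] : exists2 c, c \in `[0, x]%R &
    (sin x - x) - (sin 0 - 0) = (cos c - 1) * (x - 0).
  apply: (@MVT_segment _ (fun y => sin y - y) (fun y => cos y - 1)) => //.
  apply: continuous_subspaceT => y; apply: continuousB => //.
  exact: continuous_sin.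
rewrite sin0 !subr0 => ->.
move: cx; rewrite in_itv/= => /andP[c0 cx].
rewrite normrM (ger0_norm x0) expr2 mulrA; apply: ler_wpM2r => //.
apply: (@le_trans _ _ (2 * c)); last by rewrite ler_pM2l.
have [c1|c1] := leP c 1; last first.
  have := cos_le1 c; have := cos_geN1 c => *; rewrite ler_norml; lra.
by apply: le_trans (cosB1_le c) _; nra.
Qed.

End trigonometric_sums.

(** * Smoothness of trigonometric series *)

Section trigonometric_series.
Variable R : realType.
Implicit Types (u v w : int -> R[i]) (s h x : R) (k : int) (n N : nat).

(** A quadratic error bound gives the derivative, and unlike differentiability it
    passes to pointwise limits of functions. *)
Lemma is_derive_quadratic (f : R -> R) s (l K : R) :
  (forall h, `|f (s + h) - f s - h * l| <= K * h ^+ 2) -> is_derive s 1 f l.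
Proof.
move=> fK.
have cv : h^-1 *: ((f \o shift s) (h *: (1 : R)) - f s) @[h --> 0^'] --> l.
  apply/cvgrPdist_le => /= e e0.
  near=> h.
  have h0 : h != 0 by near: h; exact: nbhs_dnbhs_neq.
  have := fK h; rewrite /shift/= scaler1 [h + s]addrC.
  set a := f (s + h) - f s => aK.
  have -> : l - h^-1 *: a = - (h^-1 * (a - h * l)).
    by rewrite mulrBr mulKf// opprB.
  rewrite normrN normrM normfV ler_pdivrMl ?normr_gt0//.
  apply: (le_trans aK); rewrite -[h ^+ 2]real_normK ?num_real// expr2 mulrCA.
  apply: ler_wpM2l => //.
  apply: (@le_trans _ _ ((`|K| + 1) * `|h|)).
    by apply: ler_wpM2r => //; rewrite (le_trans (ler_norm _))// lerDl.
  rewrite mulrC -ler_pdivlMr ?ltr_wpDl//.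
  near: h; apply: dnbhs0_le; rewrite divr_gt0// ltr_wpDl//.
apply: DeriveDef; first by apply/cvg_ex; exists l.
exact: cvg_lim cv.
Unshelve. all: by end_near. Qed.

Definition ik k : R[i] := Complex 0 k%:~R.
Definition absk k : R[i] := real_complex R `|k%:~R|.

Lemma normc_ik k : normc (ik k) = `|k|%N%:R.
Proof. by rewrite /= expr0n add0r sqrtr_sqr -intr_norm -abszE. Qed.

Lemma normc_absk k : normc (absk k) = `|k|%N%:R.
Proof. by rewrite /= expr0n addr0 sqrtr_sqr normr_id -intr_norm -abszE. Qed.

Lemma decays_ik u : decays u -> decays (fun k => ik k * u k).
Proof. by apply: decaysM => k; rewrite normc_ik. Qed.

Lemma decays_absk u : decays u -> decays (fun k => absk k * u k).
Proof. by apply: decaysM => k; rewrite normc_absk. Qed.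

Lemma expi_taylor (x : R) : normc (expi x - 1 - Complex 0 x) <= 3 * x ^+ 2.
Proof.
apply: (le_trans (normc_le _)); rewrite /= !oppr0 !addr0.
have := cosB1_le x; have := sinBid_le x; lra.
Qed.

(** The second-order Taylor error of the k-th term is at most 3 k^2 |u k| h^2, and
    these constants are summable; so the quadratic error bound holds for all the
    partial sums with one constant. *)
Lemma tser_is_derive u s : decays u ->
  is_derive s 1 (tser u) (tser (fun k => ik k * u k) s).
Proof.
move=> du; have du1 := decays_ik du; have [C [r [C0 r0 r1 uC]]] := decays_ik du1.
have [|K KP] :=
  @symsum_bounded _ (fun k => normc (ik k * (ik k * u k))) C r C0 r0 r1.
  by move=> k; rewrite ger0_norm ?normc_ge0.
apply: (@is_derive_quadratic _ _ _ (3 * K)) => h.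
have cv : `|complex.Re (tpoly u (s + h) n) - complex.Re (tpoly u s n) -
    h * complex.Re (tpoly (fun k => ik k * u k) s n)| @[n --> \oo] -->
    `|tser u (s + h) - tser u s - h * tser (fun k => ik k * u k) s|.
  apply: cvg_norm; apply: cvgB; first by apply: cvgB; exact: tser_cvg.
  by apply: cvgMr; exact: tser_cvg.
rewrite -(cvg_lim (@Rhausdorff R) cv); apply: limr_le.
  by apply/cvg_ex; eexists; exact: cv.
near=> N.
have hRe (z : R[i]) : h * complex.Re z = complex.Re (real_complex R h * z).
  by case: z => a b /=; rewrite mul0r subr0.
rewrite hRe -!raddfB; apply: (le_trans (Re_le_normc _)).
have -> : tpoly u (s + h) N - tpoly u s N -
    real_complex R h * tpoly (fun k => ik k * u k) s N =
  \sum_(j < N.*2.+1) let k := j%:Z - N%:Z in u k * expi (k%:~R * s) *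
    (expi (k%:~R * h) - 1 - Complex 0 (k%:~R * h)).
  rewrite /tpoly mulr_sumr -!sumrB; apply: eq_bigr => j _ /=.
  set k := (Posz j - Posz N); rewrite [k%:~R * (s + h)]mulrDr expiD.
  have -> : Complex 0 (k%:~R * h) = real_complex R h * ik k.
    by rewrite /ik; simpc; rewrite mulrC.
  ring.
apply: (@le_trans _ _ (\sum_(j < N.*2.+1) let k := j%:Z - N%:Z in
    3 * h ^+ 2 * normc (ik k * (ik k * u k)))).
  elim/big_ind2: _ => [||j _ /=].
  - by rewrite normc0.
  - by move=> x1 y1 x2 y2 xy1 xy2; apply: (le_trans (le_normcD _ _)); exact: lerD.
  - set k := (Posz j - Posz N); rewrite !normcM normc_ik normc_expi mulr1.
    apply: (@le_trans _ _ (normc (u k) * (3 * (k%:~R * h) ^+ 2))).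
      apply: ler_wpM2l; [exact: normc_ge0|exact: expi_taylor].
    rewrite exprMn -[k%:~R ^+ 2]real_normK ?num_real// -intr_norm -abszE.
    by rewrite le_eqVlt; apply/orP; left; apply/eqP; ring.
rewrite /= -mulr_sumr [3 * K * _]mulrAC; apply: ler_wpM2l.
  by rewrite mulr_ge0// sqr_ge0.
by apply: le_trans (KP N); exact: ler_norm.
Unshelve. all: by end_near. Qed.

Lemma derive1_tser u : decays u ->
  ((tser u)^`())%classic = tser (fun k => ik k * u k).
Proof.
move=> du; apply/funext => s; rewrite derive1E.
by have dd := tser_is_derive s du; rewrite derive_val.
Qed.

Lemma tser_smooth u n s : decays u -> derivable (((tser u)^`(n))%classic) s 1.
Proof.
elim: n u => [|n IH] u du /=.
  exact: (ex_derive (is_derive := tser_is_derive s du)).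
rewrite -iterS iterSr [X in iter n _ X](derive1_tser du).
exact/IH/decays_ik.
Qed.

(** The symmetry of the coefficients of a real function; it makes the symmetric
    partial sums real, so that the real part of a product of partial sums is the
    product of the real parts. *)
Definition hermitian u := forall k, u (- k) = conjc (u k).

Lemma hermitian_ik u : hermitian u -> hermitian (fun k => ik k * u k).
Proof.
move=> hu k; rewrite hu rmorphM; congr (_ * _).
by rewrite /ik /= mulrNz.
Qed.

Lemma hermitian_absk u : hermitian u -> hermitian (fun k => absk k * u k).
Proof.
move=> hu k; rewrite hu rmorphM; congr (_ * _).
by rewrite /absk /= mulrNz normrN oppr0.
Qed.

Lemma tpoly_real u s N : hermitian u ->
  tpoly u s N = real_complex R (complex.Re (tpoly u s N)).
Proof.
move=> hu; elim: N => [|N].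
  rewrite /tpoly big_ord1 /= subrr mul0r expi0 mulr1.
  have := hu 0; rewrite oppr0; case: (u 0) => a b [ab] /=; congr Complex.
  by lra.
move=> IH; rewrite /tpoly (symsumS (fun k => u k * expi (k%:~R * s))).
rewrite -/(tpoly u s N) IH.
rewrite hu mulrNz mulNr -conj_expi -rmorphM.
move: (u N.+1 * _) (complex.Re (tpoly u s N)) => [a b] c; congr Complex => /=.
by rewrite subrr addr0.
Qed.
End trigonometric_series.
Arguments ik {R} k.
Arguments absk {R} k.

(** * Fourier coefficients and integrals over the circle *)

Section fourier_coefficients.
Variable R : realType.
Implicit Types (u v w : int -> R[i]) (s h x : R) (k : int) (n N : nat).

Local Notation mu := (@lebesgue_measure R).
Local Notation I2pi := (`[0, 2 * pi]%classic : set R).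

Lemma measurable_I2pi : measurable (I2pi : set (measurableTypeR R)).
Proof. exact: measurable_itv. Qed.

Lemma mu_I2pi : mu I2pi = (2 * pi)%:E.
Proof.
by rewrite lebesgue_measure_itv/= lte_fin mulr_gt0 ?pi_gt0// -EFinB subr0.
Qed.

Lemma I2pi_fin : (mu I2pi < +oo)%E.
Proof. by rewrite mu_I2pi ltry. Qed.

Definition torus_cint (F : R -> R[i]) : R[i] := cint mu I2pi F.

Lemma bmeas_continuous (D : set R) (f : R -> R) (K : R) :
  continuous f -> (forall x, `|f x| <= K) -> bmeas (D : set (measurableTypeR R)) f.
Proof.
move=> cf fK; split; last by exists K.
by apply: (@measurable_funS _ _ _ _ setT) => //; exact: continuous_measurable_fun.
Qed.

Lemma continuous_scale (c : R) : continuous (fun x : R => c * x).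
Proof. by move=> x; apply: cvgMr; exact: cvg_id. Qed.

Lemma continuous_cosM (c : R) : continuous (fun x : R => cos (c * x)).
Proof.
move=> x; apply: (@continuous_comp R R R (fun x => c * x) (@cos R)).
  exact: continuous_scale.
exact: continuous_cos.
Qed.

Lemma continuous_sinM (c : R) : continuous (fun x : R => sin (c * x)).
Proof.
move=> x; apply: (@continuous_comp R R R (fun x => c * x) (@sin R)).
  exact: continuous_scale.
exact: continuous_sin.
Qed.

Lemma cbmeas_expi k : cbmeas I2pi (fun s => expi (k%:~R * s) : R[i]).
Proof.
split; apply: (@bmeas_continuous _ _ 1).
- exact: continuous_cosM.
- by move=> x; exact: cos_max.
- exact: continuous_sinM.
- by move=> x; exact: sin_max.
Qed.

Lemma Re_realM (c : R) (z : R[i]) :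
  complex.Re (real_complex R c * z) = c * complex.Re z.
Proof. by case: z => a b /=; rewrite mul0r subr0. Qed.

Lemma Im_realM (c : R) (z : R[i]) :
  complex.Im (real_complex R c * z) = c * complex.Im z.
Proof. by case: z => a b /=; rewrite mul0r addr0. Qed.

Lemma cbmeas_expiN k : cbmeas I2pi (fun s => expi (- (k%:~R * s)) : R[i]).
Proof.
rewrite (_ : (fun _ => _) = (fun s => expi ((- k)%:~R * s))).
  exact: cbmeas_expi.
by apply/funext => s; rewrite mulrNz mulNr.
Qed.

Lemma cbmeas_cexpi (c : R[i]) k : cbmeas I2pi (fun s => c * expi (k%:~R * s)).
Proof. by apply: (cbmeasM (cbmeas_cst _ c)); exact: cbmeas_expi. Qed.

Lemma cbmeas_tpoly u N : cbmeas I2pi (tpoly u ^~ N).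
Proof. by apply: cbmeas_sum => j; exact: cbmeas_cexpi. Qed.

(** The fundamental theorem of calculus over one period. *)
Lemma torus_integral_derive (f F : R -> R) : continuous f ->
  (forall x, is_derive x 1 F (f x)) ->
  torus_integral f = F (2 * pi) - F 0.
Proof.
move=> cf dF; rewrite /torus_integral /Rintegral (@continuous_FTC2 _ f F)//.
- by rewrite mulr_gt0// pi_gt0.
- exact: continuous_subspaceT.
- have cF : continuous F.
    move=> x; apply: differentiable_continuous; apply/derivable1_diffP.
    by have dd := dF x; exact: ex_derive.
  split.
  + by move=> x _; have dd := dF x; exact: ex_derive.
  + by apply: cvg_at_right_filter; exact: cF.
  + by apply: cvg_at_left_filter; exact: cF.
- by move=> x _; rewrite derive1E; have dd := dF x; rewrite derive_val.
Qed.

Lemma torus_cint_expi k : torus_cint (fun s => expi (k%:~R * s)) =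
  if k == 0 then real_complex R (2 * pi) else 0.
Proof.
case: eqVneq => [->|k0].
  rewrite /torus_cint /cint /expi.
  under eq_Rintegral do rewrite mul0r cos0.
  under [X in Complex _ X]eq_Rintegral do rewrite mul0r sin0.
  rewrite !Rintegral_cst; [|exact: measurable_I2pi..].
  by rewrite mul0r mul1r; congr Complex; rewrite -[RHS]/(fine (2 * pi)%:E) -mu_I2pi.
have kR : k%:~R != 0 :> R by rewrite intr_eq0.
have e2pi : expi (k%:~R * (2 * pi)) = 1 :> R[i].
  by rewrite -[k%:~R * _]add0r expi_period expi0.
have [c1 s0] : cos (k%:~R * (2 * pi)) = 1 :> R /\ sin (k%:~R * (2 * pi)) = 0 :> R.
  by case: e2pi.
rewrite /torus_cint /cint; congr Complex; rewrite -/(torus_integral _).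
  have dF x : is_derive x 1 (fun x => k%:~R^-1 * sin (k%:~R * x)) (cos (k%:~R * x)).
    apply: is_derive_eq; rewrite /GRing.scale/=.
    by rewrite !mulr1; field.
  rewrite (torus_integral_derive (@continuous_cosM _) dF).
  by rewrite s0 !mulr0 sin0 !mulr0 subrr.
have dF x : is_derive x 1 (fun x => - k%:~R^-1 * cos (k%:~R * x)) (sin (k%:~R * x)).
  apply: is_derive_eq; rewrite /GRing.scale/=.
  by rewrite !mulr1; field.
rewrite (torus_integral_derive (@continuous_sinM _) dF).
by rewrite c1 !mulr0 cos0 subrr.
Qed.

Lemma symsum_delta (V : zmodType) (F : int -> V) n k : (`|k| <= n)%N ->
  \sum_(j < n.*2.+1) (if j%:Z - n%:Z == k then F (j%:Z - n%:Z) else 0) = F k.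
Proof.
move=> kn; have jP : (absz (k + n%:Z)%R < n.*2.+1)%N by lia.
rewrite (bigD1 (Ordinal jP))//= big1 => [|j /eqP jk]; last first.
  by case: eqP => // jE; case: jk; apply: val_inj => /=; lia.
have -> : (absz (k + n))%:Z - n%:Z = k by lia.
by rewrite eqxx addr0.
Qed.

(** Orthogonality of the exponentials; the coefficient is exact as soon as the
    cutoff reaches k. *)
Lemma torus_cint_tpoly u n k : (`|k| <= n)%N ->
  torus_cint (fun s => tpoly u s n * expi (- (k%:~R * s))) =
  real_complex R (2 * pi) * u k.
Proof.
move=> kn.
have -> : (fun s => tpoly u s n * expi (- (k%:~R * s))) =
    (fun s => \sum_(j < n.*2.+1) u (j%:Z - n%:Z) * expi ((j%:Z - n%:Z - k)%:~R * s)).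
  apply/funext => s; rewrite mulr_suml; apply: eq_bigr => j _.
  by rewrite -mulrA -expiD -mulrBl -intrB.
have bm j : cbmeas I2pi (fun s =>
    u (Posz j - n%:Z) * expi ((j%:Z - n%:Z - k)%:~R * s)).
  exact: cbmeas_cexpi.
rewrite /torus_cint (cint_sum measurable_I2pi I2pi_fin); last by move=> j; exact: bm.
rewrite -[RHS](symsum_delta (fun k => real_complex R (2 * pi) * u k) kn).
apply: eq_bigr => j _; rewrite (cintZ measurable_I2pi I2pi_fin)//;
  last exact: cbmeas_expi.
rewrite -/(torus_cint _) torus_cint_expi subr_eq0; case: ifP => _.
  by rewrite mulrC.
by rewrite mulr0.
Qed.

Lemma torus_bounded_cvg (f_ : (R -> R)^nat) f (K : R) :
  (forall n, bmeas I2pi (f_ n)) ->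
  (forall n x, `|f_ n x| <= K) ->
  (forall x, f_ ^~ x @ \oo --> f x) ->
  torus_integral (f_ n) @[n --> \oo] --> torus_integral f.
Proof.
move=> bf fK ff.
exact: (bounded_cvg measurable_I2pi I2pi_fin (fun n => (bf n).1)
  (fun n x _ => fK n x) (fun x _ => ff x)).2.
Qed.

(** By bounded convergence the coefficient of the series is the limit of those of
    the partial sums, which is an eventually constant sequence. *)
Lemma fourier_coef_tser u k : decays u -> hermitian u ->
  fourier_coef (tser u) k = u k.
Proof.
move=> du hu; have [K KP] := tpoly_bounded du.
have pi0 : 2 * pi != 0 :> R by rewrite mulf_neq0// gt_eqF// pi_gt0.
have lim (g : R -> R) (l : R) : (forall s, `|g s| <= 1) -> bmeas I2pi g ->
    (forall n, (`|k| <= n)%N ->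
      torus_integral (fun s => complex.Re (tpoly u s n) * g s) = l) ->
    torus_integral (fun s => tser u s * g s) = l.
  move=> g1 bg gl.
  have cv : torus_integral (fun s => complex.Re (tpoly u s n) * g s) @[n --> \oo] -->
      torus_integral (fun s => tser u s * g s).
    apply: (@torus_bounded_cvg _ _ K).
    - by move=> n; apply: bmeasM => //; have [] := cbmeas_tpoly u n.
    - move=> n x; rewrite normrM -[leRHS]mulr1; apply: ler_pM => //.
      by apply: le_trans (KP n x); exact: Re_le_normc.
    - by move=> x; apply: cvgM; [exact: tser_cvg|exact: cvg_cst].
  apply: (cvg_unique _ cv) => //.
  apply: cvg_near_cst; near=> n.
  by rewrite gl//; near: n; exact: nbhs_infty_ge.
have JE n : (`|k| <= n)%N ->
    torus_cint (fun s => tpoly u s n * expi (- (k%:~R * s))) =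
    real_complex R (2 * pi) * u k.
  exact: torus_cint_tpoly.
have [bc bs] := cbmeas_expi k.
rewrite /fourier_coef (lim _ (2 * pi * complex.Re (u k))) //; last 2 first.
- by move=> s; exact: cos_max.
- move=> n kn; have /(congr1 (@complex.Re R)) := JE n kn.
  rewrite Re_realM => <-; apply: eq_Rintegral => s _.
  by rewrite tpoly_real// Re_realM /= cosN.
rewrite (lim _ (- (2 * pi * complex.Im (u k)))) //; last 2 first.
- by move=> s; exact: sin_max.
- move=> n kn; have /(congr1 (@complex.Im R)) := JE n kn.
  rewrite Im_realM => <-; rewrite -mulN1r /torus_cint /cint /=.
  rewrite -(RintegralZl _ measurable_I2pi); last first.
    apply: (bmeas_integrable measurable_I2pi I2pi_fin).
    have [_ h] := cbmeasM (cbmeas_tpoly u n) (cbmeas_expiN k); exact: h.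
  apply: eq_Rintegral => s _.
  by rewrite tpoly_real// Im_realM /= sinN mulrN mulN1r opprK.
by case: (u k) => a b /=; rewrite mulrN opprK !mulKf.
Unshelve. all: by end_near. Qed.

Lemma Lambda_tser u : decays u -> hermitian u ->
  Lambda (tser u) = tser (fun k => absk k * u k).
Proof.
move=> du hu; apply/funext => s; congr (limn _); apply/funext => n.
by congr complex.Re; apply: eq_bigr => j _ /=; rewrite fourier_coef_tser.
Qed.

(** Reduces integrals of products of three series to finite sums, by bounded
    convergence on the circle. *)
Lemma torus_integral_triple u v w : decays u -> decays v -> decays w ->
  hermitian u -> hermitian v -> hermitian w ->
  complex.Re (torus_cint (fun s => tpoly u s n * tpoly v s n * tpoly w s n))
    @[n --> \oo] --> torus_integral (fun s => tser u s * tser v s * tser w s).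
Proof.
move=> du dv dw hu hv hw.
have [[K KP] [L LP] [M MP]] :=
  And3 (tpoly_bounded du) (tpoly_bounded dv) (tpoly_bounded dw).
rewrite /torus_cint /cint /= -/(torus_integral _).
have -> : (fun n => torus_integral (fun s =>
      complex.Re (tpoly u s n * tpoly v s n * tpoly w s n))) =
    (fun n => torus_integral (fun s =>
      complex.Re (tpoly u s n) * complex.Re (tpoly v s n) *
      complex.Re (tpoly w s n))).
  apply/funext => n; apply: eq_Rintegral => s _.
  by rewrite tpoly_real// (tpoly_real s n hv) -mulrA !Re_realM mulrA.
apply: (@torus_bounded_cvg _ _ (K * L * M)).
- move=> n; have [[bu _] [bv _] [bw _]] :=
    And3 (cbmeas_tpoly u n) (cbmeas_tpoly v n) (cbmeas_tpoly w n).
  exact: (bmeasM (bmeasM bu bv) bw).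
- move=> n x; rewrite !normrM.
  apply: ler_pM; [exact: mulr_ge0|exact: normr_ge0|apply: ler_pM => //|].
  + by apply: le_trans (KP n x); exact: Re_le_normc.
  + by apply: le_trans (LP n x); exact: Re_le_normc.
  + by apply: le_trans (MP n x); exact: Re_le_normc.
- move=> x; apply: cvgM; last exact: tser_cvg.
  by apply: cvgM; exact: tser_cvg.
Qed.

End fourier_coefficients.

(** * The cubic form in Fourier coefficients *)

Section triple_sums.
Variable R : realType.
Implicit Types (u v w : int -> R[i]) (s h x : R) (k : int) (n N : nat).
Implicit Types W : int -> int -> int -> R[i].

(** The sum over the triples of frequencies with sum zero and entries in [-n, n]:
    the frequencies that survive when a product of three trigonometric polynomials
    is integrated. *)
Definition triple_sum n W : R[i] :=
  \sum_(a < n.*2.+1) \sum_(b < n.*2.+1) \sum_(c < n.*2.+1)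
    if (a%:Z - n%:Z) + (b%:Z - n%:Z) + (c%:Z - n%:Z) == 0
    then W (a%:Z - n%:Z) (b%:Z - n%:Z) (c%:Z - n%:Z) else 0.

Lemma eq_triple_sum n W W' : (forall a b c, a + b + c = 0 -> W a b c = W' a b c) ->
  triple_sum n W = triple_sum n W'.
Proof.
move=> WW'; do 3 (apply: eq_bigr => ? _).
by case: eqP => // /WW'.
Qed.

Lemma triple_sumD n W W' :
  triple_sum n (fun a b c => W a b c + W' a b c) =
  triple_sum n W + triple_sum n W'.
Proof.
rewrite /triple_sum -big_split; apply: eq_bigr => a _.
rewrite -big_split; apply: eq_bigr => b _.
rewrite -big_split; apply: eq_bigr => c _ /=.
by case: eqP => _; rewrite ?addr0.
Qed.

Lemma triple_sumZ n (z : R[i]) W :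
  triple_sum n (fun a b c => z * W a b c) = z * triple_sum n W.
Proof.
rewrite /triple_sum mulr_sumr; apply: eq_bigr => a _.
rewrite mulr_sumr; apply: eq_bigr => b _.
rewrite mulr_sumr; apply: eq_bigr => c _ /=.
by case: eqP => _; rewrite ?mulr0.
Qed.

Lemma triple_sum_swap12 n W : triple_sum n (fun a b c => W b a c) = triple_sum n W.
Proof.
rewrite /triple_sum exchange_big; do 3 (apply: eq_bigr => ? _).
by rewrite [X in X + _ == 0]addrC.
Qed.

Lemma triple_sum_swap23 n W : triple_sum n (fun a b c => W a c b) = triple_sum n W.
Proof.
rewrite /triple_sum; apply: eq_bigr => a _; rewrite exchange_big.
do 2 (apply: eq_bigr => ? _).
by rewrite addrAC.
Qed.

Definition sym6 (V : zmodType) (W : int -> int -> int -> V) a b c : V :=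
  W a b c + W b a c + W a c b + W b c a + W c a b + W c b a.

Lemma triple_sum_sym6 n W : triple_sum n (sym6 W) = triple_sum n W *+ 6.
Proof.
have e12 := triple_sum_swap12 n; have e23 := triple_sum_swap23 n.
rewrite /sym6 !triple_sumD (e12 (fun a b c => W a b c)) (e23 (fun a b c => W a b c)).
rewrite (_ : triple_sum n (fun a b c => W b c a) = triple_sum n W); last first.
  by rewrite (e12 (fun a b c => W a c b)) e23.
rewrite (_ : triple_sum n (fun a b c => W c a b) = triple_sum n W); last first.
  by rewrite (e23 (fun a b c => W b a c)) e12.
rewrite (_ : triple_sum n (fun a b c => W c b a) = triple_sum n W); last first.
  by rewrite (e12 (fun a b c => W c a b)) (e23 (fun a b c => W b a c)) e12.
by rewrite !mulrS mulr0n addr0 !addrA.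
Qed.

(** The product u a * u b * u c and the index set are invariant under permutations
    of the three frequencies, so only the symmetrization of the weight counts. *)
Lemma triple_sum_symmetrized n u (w w' : int -> int -> int -> R) :
  (forall a b c, a + b + c = 0 -> sym6 w a b c = sym6 w' a b c) ->
  triple_sum n (fun a b c => u a * u b * u c * real_complex R (w a b c)) =
  triple_sum n (fun a b c => u a * u b * u c * real_complex R (w' a b c)).
Proof.
move=> ww'; have six : 6%:R != 0 :> R[i] by rewrite pnatr_eq0.
apply: (mulIf six); rewrite !mulr_natr -!triple_sum_sym6.
apply: eq_triple_sum => a b c abc.
have symE (f : int -> int -> int -> R) :
    sym6 (fun a b c => u a * u b * u c * real_complex R (f a b c)) a b c =
    u a * u b * u c * real_complex R (sym6 f a b c).
  by rewrite /sym6 !raddfD/=; ring.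
by rewrite !symE ww'.
Qed.

(** The decisive algebraic identity. The left weight comes from 2 I1 + I2; in the
    right one only x < 0 < y survive, and there it is 2 |x| |y| (|x| + |y|). For
    the frequencies a, b, - (a + b) with a, b >= 0 both symmetrizations equal
    4 (a + b) (a^2 + a b + b^2). The point of the right weight is that it no longer
    involves the third frequency z, so that it can be the weight of a quadratic
    form in u x and u y with a Toeplitz factor u z. *)
Lemma symbol_identity (a b c : R) : a + b + c = 0 ->
  let w x y z := - (2 * `|y| * y * z + `|x| * y * z) in
  let w' x y z := (`|x| - x) * (`|y| + y) * (`|x| - x + (`|y| + y)) / 4 in
  w a b c + w b a c + w a c b + w b c a + w c a b + w c b a =
  w' a b c + w' b a c + w' a c b + w' b c a + w' c a b + w' c b a.
Proof.
move=> abc; have -> : c = - (a + b) by lra.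
rewrite /= normrN.
have [a0|/ltW a0] := leP 0 a; have [b0|/ltW b0] := leP 0 b;
  have [ab0|/ltW ab0] := leP 0 (a + b);
  rewrite ?(ger0_norm a0) ?(ler0_norm a0) ?(ger0_norm b0) ?(ler0_norm b0)
     ?(ger0_norm ab0) ?(ler0_norm ab0); by field.
Qed.

Definition cubic_symbol (a b c : int) : R :=
  - (2 * `|b%:~R| * b%:~R * c%:~R + `|a%:~R| * b%:~R * c%:~R).

Definition split_symbol (a b c : int) : R :=
  (`|a%:~R| - a%:~R) * (`|b%:~R| + b%:~R) *
    (`|a%:~R| - a%:~R + (`|b%:~R| + b%:~R)) / 4.

Lemma symsum_split (V : zmodType) (F : int -> V) n :
  \sum_(j < n.*2.+1) F (j%:Z - n%:Z) = F 0 + \sum_(i < n) (F i.+1 + F (- i.+1%:Z)).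
Proof.
elim: n => [|n IH]; first by rewrite big_ord1 big_ord0 [RHS]addr0.
by rewrite symsumS IH big_ord_recr/= -addrA.
Qed.

(** Only a = - (i + 1) and b = j + 1 contribute; the third frequency i - j is then
    in the range of summation, so the cutoff costs nothing. *)
Lemma triple_sum_split_symbol n u :
  triple_sum n (fun a b c => u a * u b * u c * real_complex R (split_symbol a b c)) =
  \sum_(i < n) \sum_(j < n)
    real_complex R (2 * i.+1%:R * j.+1%:R * (i.+1%:R + j.+1%:R)) *
    (u (- i.+1%:Z) * u j.+1 * u (i%:Z - j%:Z)).
Proof.
pose G a b := \sum_(c < n.*2.+1)
  if a + b + (c%:Z - n%:Z) == 0
  then u a * u b * u (c%:Z - n%:Z) *
    real_complex R (split_symbol a b (c%:Z - n%:Z)) else 0.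
have Ga0 a b : 0 <= a -> G a b = 0.
  move=> a0; rewrite /G big1// => c _; case: eqP => // _.
  by rewrite /split_symbol (@ger0_norm _ a%:~R) ?ler0z// subrr !mul0r mulr0.
have Gb0 a b : b <= 0 -> G a b = 0.
  move=> b0; rewrite /G big1// => c _; case: eqP => // _.
  by rewrite /split_symbol (@ler0_norm _ b%:~R) ?lerz0// addNr mulr0 !mul0r mulr0.
rewrite /triple_sum (symsum_split (fun a => \sum_(b < n.*2.+1) G a (b%:Z - n%:Z))).
rewrite big1 ?add0r => [|b _]; last exact: Ga0.
apply: eq_bigr => i _; rewrite big1 ?add0r => [|b _]; last exact: Ga0.
rewrite (symsum_split (fun b => G (- i.+1%:Z) b)) Gb0// add0r.
apply: eq_bigr => j _; rewrite [X in _ + X]Gb0; last by lia.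
rewrite addr0 /G.
have kn : (`|(i%:Z - j%:Z)%R| <= n)%N by have := ltn_ord i; have := ltn_ord j; lia.
rewrite -(symsum_delta (fun c => _ * (u (- i.+1%:Z) * u j.+1 * u c)) kn).
apply: eq_bigr => c _.
rewrite (_ : (_ + _ == 0) = (c%:Z - n%:Z == i%:Z - j%:Z)); last first.
  by apply/eqP/eqP; lia.
case: eqP => // _; rewrite mulrC; congr (real_complex R _ * _).
rewrite /split_symbol mulrNz normrN !ger0_norm ?ler0z//.
by rewrite -!pmulrn; field.
Qed.

Lemma torus_cint_triple u v w n :
  torus_cint (fun s => tpoly u s n * tpoly v s n * tpoly w s n) =
  real_complex R (2 * pi) * triple_sum n (fun a b c => u a * v b * w c).
Proof.
pose E (j : nat) (s : R) : R[i] := expi ((j%:Z - n%:Z)%:~R * s).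
have -> : (fun s => tpoly u s n * tpoly v s n * tpoly w s n) =
  (fun s => \sum_(a < n.*2.+1) \sum_(b < n.*2.+1) \sum_(c < n.*2.+1)
    (u (a%:Z - n%:Z) * v (b%:Z - n%:Z) * w (c%:Z - n%:Z)) *
    expi (((a%:Z - n%:Z) + (b%:Z - n%:Z) + (c%:Z - n%:Z))%:~R * s)).
  apply/funext => s; rewrite /tpoly -mulrA mulr_suml; apply: eq_bigr => a _.
  rewrite -mulrA mulr_suml !mulr_sumr; apply: eq_bigr => b _.
  rewrite !mulr_sumr; apply: eq_bigr => c _.
  rewrite !intrD !mulrDl !expiD -!/(E _ _); ring.
rewrite /torus_cint (cint_sum (@measurable_I2pi R) (@I2pi_fin R)); last first.
  by move=> a; do 2 (apply: cbmeas_sum => ?); exact: cbmeas_cexpi.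
rewrite mulr_sumr; apply: eq_bigr => a _.
rewrite (cint_sum (@measurable_I2pi R) (@I2pi_fin R)); last first.
  by move=> b; apply: cbmeas_sum => ?; exact: cbmeas_cexpi.
rewrite mulr_sumr; apply: eq_bigr => b _.
rewrite (cint_sum (@measurable_I2pi R) (@I2pi_fin R)); last first.
  by move=> c; exact: cbmeas_cexpi.
rewrite mulr_sumr; apply: eq_bigr => c _.
rewrite (cintZ (@measurable_I2pi R) (@I2pi_fin R)); last exact: cbmeas_expi.
rewrite -/(torus_cint _) torus_cint_expi; case: eqP => _; first by rewrite mulrC.
by rewrite !mulr0.
Qed.

(** The factors i of the two derivatives contribute - b c, which is the sign in
    [cubic_symbol]. *)
Lemma cubic_form_cvg u : decays u -> hermitian u ->
  2 * pi * complex.Re (\sum_(i < n) \sum_(j < n)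
    real_complex R (2 * i.+1%:R * j.+1%:R * (i.+1%:R + j.+1%:R)) *
    (u (- i.+1%:Z) * u j.+1 * u (i%:Z - j%:Z))) @[n --> \oo] -->
  2 * I1 (tser u) + I2 (tser u).
Proof.
move=> du hu.
have [d1 h1] := (decays_ik du, hermitian_ik hu).
have [d2 h2] := (decays_absk du, hermitian_absk hu).
have [d3 h3] := (decays_absk d1, hermitian_absk h1).
have cI1 := torus_integral_triple du d3 d1 hu h3 h1.
have cI2 := torus_integral_triple d2 d1 d1 h2 h1 h1.
have -> : I1 (tser u) = torus_integral (fun s => tser u s *
    tser (fun k => absk k * (ik k * u k)) s * tser (fun k => ik k * u k) s).
  by rewrite /I1 derive1_tser// Lambda_tser.
have -> : I2 (tser u) = torus_integral (fun s => tser (fun k => absk k * u k) s *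
    tser (fun k => ik k * u k) s * tser (fun k => ik k * u k) s).
  rewrite /I2 derive1_tser// Lambda_tser//; congr torus_integral.
  by apply/funext => s; rewrite expr2 mulrA.
rewrite [X in X @ _ --> _](_ : _ = fun n =>
   2 * complex.Re (torus_cint (fun s => tpoly u s n *
    tpoly (fun k => absk k * (ik k * u k)) s n * tpoly (fun k => ik k * u k) s n)) +
   complex.Re (torus_cint (fun s => tpoly (fun k => absk k * u k) s n *
    tpoly (fun k => ik k * u k) s n * tpoly (fun k => ik k * u k) s n))).
  by apply: cvgD => //; apply: cvgM => //; exact: cvg_cst.
apply/funext => n; rewrite -triple_sum_split_symbol.
rewrite -(@triple_sum_symmetrized _ _ cubic_symbol); last first.
  move=> a b c abc; apply: symbol_identity.
  by rewrite -!intrD abc.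
rewrite !torus_cint_triple. rewrite !Re_realM mulrCA -mulrDr; congr (_ * _).
rewrite -Re_realM -raddfD -triple_sumZ -triple_sumD; congr complex.Re.
apply: eq_triple_sum => a b c _; rewrite /cubic_symbol /absk /ik.
have ikE (x : R) : Complex 0 x = Complex 0 1 * real_complex R x.
  by apply/eqP; rewrite eq_complex /=; apply/andP; split; apply/eqP; ring.
have ii : Complex 0 1 * Complex 0 1 = -1 :> R[i] by rewrite -expr2 sqr_i.
rewrite !(ikE _%:~R); move: (Complex 0 1 : R[i]) ii => i ii.
rewrite raddfN raddfD /= !rmorphM /=.
transitivity ((i * i) * (u a * u b * u c *
  (real_complex R 2 * real_complex R `|b%:~R| * real_complex R b%:~R *
     real_complex R c%:~R +
   real_complex R `|a%:~R| * real_complex R b%:~R * real_complex R c%:~R))).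
  by rewrite ii; ring.
by ring.
Qed.

End triple_sums.

(** * Positive semidefinite kernels of the maximum *)

Section positive_kernels.
Variable R : realType.

(** A kernel h (max i j) with h decreasing to a nonnegative limit is a positive
    combination of the rank-one kernels 1_(i <= k) 1_(j <= k): summation by parts
    writes the form as a sum of (h k - h (k + 1)) P_k^2 over the partial sums P_k
    of p. Keeping one term gives the bound. *)
Lemma staircase_kernel (h p : nat -> R) n l :
  (forall k, h k.+1 <= h k) -> (forall k, 0 <= h k) -> (l < n)%N ->
  (h l - h l.+1) * (\sum_(i < l.+1) p i) ^+ 2 <=
  \sum_(i < n) \sum_(j < n) h (maxn i j) * (p i * p j).
Proof.
move=> hS h0 ln; pose P k := \sum_(i < k) p i.
have E : \sum_(i < n) \sum_(j < n) h (maxn i j) * (p i * p j) =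
    \sum_(k < n) (h k - h k.+1) * P k.+1 ^+ 2 + h n * P n ^+ 2.
  elim: n {ln} => [|n IH]; first by rewrite !big_ord0 add0r /P big_ord0 expr0n mulr0.
  have row : \sum_(j < n) h (maxn n j) * (p n * p j) = h n * (p n * P n).
    rewrite /P !mulr_sumr; apply: eq_bigr => j _.
    by rewrite (maxn_idPl (ltnW (ltn_ord j))).
  have col : \sum_(i < n) h (maxn i n) * (p i * p n) = h n * (p n * P n).
    rewrite /P !mulr_sumr; apply: eq_bigr => j _.
    by rewrite (maxn_idPr (ltnW (ltn_ord j))) [p j * _]mulrC.
  rewrite big_ord_recr/= big_ord_recr/= row maxnn.
  under eq_bigr do rewrite big_ord_recr/=.
  rewrite big_split/= IH col big_ord_recr/=.
  have -> : P n.+1 = P n + p n by rewrite /P big_ord_recr.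
  by ring.
rewrite E (bigD1 (Ordinal ln))//= -addrA lerDl addr_ge0//.
  by apply: sumr_ge0 => k _; rewrite mulr_ge0 ?subr_ge0 ?sqr_ge0.
by rewrite mulr_ge0 ?sqr_ge0.
Qed.

Variable q : R.

Definition lin_weight (k : nat) : R := k.+1%:R * q ^+ (k.+1.*2).
Definition inv_weight (k : nat) : R := q ^+ (k.+1.*2) / k.+1%:R.

Hypotheses (q0 : 0 < q) (q1 : q <= 1 / 2).

Let qX (k : nat) : 0 < q ^+ (k.+1.*2). Proof. exact: exprn_gt0. Qed.

(** The decay of the powers of q, which has to beat the growth of the factor l + 1
    in [lin_weight]. *)
Let qXS (k : nat) : q ^+ (k.+2.*2) <= q ^+ (k.+1.*2) / 4.
Proof.
have -> : q ^+ (k.+2.*2) = q * q * q ^+ (k.+1.*2).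
  by rewrite [k.+2.*2]doubleS 2!exprS mulrA.
move: (q ^+ _) (qX k) => x x0.
have : q * q <= 1 / 2 * (1 / 2) by apply: ler_pM => //; exact: ltW.
by move=> qq; have := ler_wpM2r (ltW x0) qq; lra.
Qed.

(** The ratio of consecutive weights is q^2 (k + 2) / (k + 1) <= 2 q^2 < 1. *)
Lemma lin_weight_lt (k : nat) : lin_weight k.+1 < lin_weight k.
Proof.
rewrite /lin_weight; have := qXS k; have := qX k.
have : (1 : R) <= k.+1%:R by rewrite ler1n.
rewrite -[k.+2%:R]natr1.
move: (k.+1%:R : R) (q ^+ (k.+1.*2)) (q ^+ (k.+2.*2)) => a x y a1 x0 yx.
have : (a + 1) * y <= (a + 1) * (x / 4) by rewrite ler_wpM2l//; lra.
have : x <= a * x by rewrite ler_peMl// ltW.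
lra.
Qed.

Lemma inv_weight_le (k : nat) : inv_weight k.+1 <= inv_weight k.
Proof.
rewrite /inv_weight; apply: ler_pM.
- exact/ltW/qX.
- by rewrite invr_ge0.
- by apply: (le_trans (qXS k)); have := qX k; lra.
- by rewrite lef_pV2 ?posrE// ler_nat.
Qed.

(** With M and N the larger and the smaller of i + 1 and j + 1, the left side is
    M N (M + N) q^(2 M): the summand M gives the first kernel, and N = M N / M the
    second one. Both are kernels of the maximum up to a diagonal scaling. *)
Lemma weight_split (i j : nat) :
  i.+1%:R * j.+1%:R * (i.+1%:R + j.+1%:R) * q ^+ ((maxn i j).+1.*2) =
  lin_weight (maxn i j) * (i.+1%:R * j.+1%:R) +
  inv_weight (maxn i j) * (i.+1%:R ^+ 2 * j.+1%:R ^+ 2) :> R.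
Proof.
have nz k : k.+1%:R != 0 :> R by rewrite pnatr_eq0.
rewrite /lin_weight /inv_weight; have := nz j; have := nz i.
by case: (leqP i j) => _;
  move: (i.+1%:R : R) (j.+1%:R : R) (q ^+ _) => x y z *; field.
Qed.

(** Both kernels of [weight_split] are positive semidefinite; only the term of
    index l of the first one is kept. *)
Lemma weighted_form_ge (p : nat -> R) n l : (l < n)%N ->
  (lin_weight l - lin_weight l.+1) * (\sum_(i < l.+1) i.+1%:R * p i) ^+ 2 <=
  \sum_(i < n) \sum_(j < n)
    i.+1%:R * j.+1%:R * (i.+1%:R + j.+1%:R) * q ^+ ((maxn i j).+1.*2) * (p i * p j).
Proof.
move=> ln.
rewrite [leRHS](_ : _ =
   \sum_(i < n) \sum_(j < n) lin_weight (maxn i j) *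
     ((i.+1%:R * p i) * (j.+1%:R * p j)) +
   \sum_(i < n) \sum_(j < n) inv_weight (maxn i j) *
     ((i.+1%:R ^+ 2 * p i) * (j.+1%:R ^+ 2 * p j))).
  have h1S k : lin_weight k.+1 <= lin_weight k by exact/ltW/lin_weight_lt.
  have h10 k : 0 <= lin_weight k by rewrite /lin_weight mulr_ge0// ltW.
  have h20 k : 0 <= inv_weight k by rewrite /inv_weight divr_ge0// ltW.
  have := staircase_kernel (fun i => i.+1%:R * p i) h1S h10 ln.
  have := staircase_kernel (fun i => i.+1%:R ^+ 2 * p i) inv_weight_le h20 ln.
  have : 0 <= (inv_weight l - inv_weight l.+1) *
      (\sum_(i < l.+1) i.+1%:R ^+ 2 * p i) ^+ 2.
    by rewrite mulr_ge0 ?sqr_ge0// subr_ge0 inv_weight_le.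
  lra.
rewrite -big_split; apply: eq_bigr => i _.
rewrite -big_split; apply: eq_bigr => j _ /=.
by rewrite weight_split; ring.
Qed.

End positive_kernels.

(** * Poisson integrals of a probability measure *)

Section torus_moments.
Variables (R : realType) (mu : probability (borel_torus R) R).
Implicit Types (u : int -> R[i]) (s x : R) (k : int) (n : nat).

Local Notation angle theta := (repr (theta : torus R) : R).

(** A point of the circle is handled through its chosen representative, which is
    not a continuous function; a continuous periodic function of it is continuous
    for the quotient topology, hence Borel. *)
Lemma measurable_periodic (g : R -> R) : continuous g ->
  (forall x k, g (x + k%:~R * (2 * pi)) = g x) ->
  measurable_fun setT (fun theta : borel_torus R => g (angle theta)).
Proof.
move=> cg pg; have cgr : continuous ((fun theta => g (angle theta)) : torus R -> R).
  apply: (@repr_comp_continuous R {eq_quot @eq_mod2pi R}%qT R g cg).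
  move=> a b /eqP ab; apply/eqP.
  have : eq_mod2pi a b.
    rewrite -(@eqmodE R (eq_mod2pi_equiv R)); exact/eqP.
  by move=> /asboolP[k kE]; rewrite -(pg b k) -kE addrC subrK.
move=> mT; apply: (measurability _ (RGenOInfty.measurableE R)); last exact: mT.
move=> _ [_ [a ->] <-]; rewrite setTI.
apply: sub_sigma_algebra.
move/continuousP : cgr; apply; exact: interval_open.
Qed.

Lemma cbmeas_angle k :
  cbmeas setT (fun theta : borel_torus R => expi (k%:~R * angle theta) : R[i]).
Proof.
have per j x : expi (k%:~R * (x + j%:~R * (2 * pi))) = expi (k%:~R * x) :> R[i].
  by rewrite mulrDr mulrA -intrM expi_period.
split; split.
- apply: (@measurable_periodic (fun x => cos (k%:~R * x))).
    exact: continuous_cosM.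
  by move=> x j; have [] := per j x.
- by exists 1 => x _; exact: cos_max.
- apply: (@measurable_periodic (fun x => sin (k%:~R * x))).
    exact: continuous_sinM.
  by move=> x j; have [] := per j x.
- by exists 1 => x _; exact: sin_max.
Qed.

Definition moment k : R[i] :=
  cint mu setT (fun theta => expi (- (k%:~R * angle theta))).

Let muT_fin : (mu setT < +oo)%E.
Proof. by rewrite probability_setT ltry. Qed.

Lemma cbmeas_angleN k :
  cbmeas setT (fun theta : borel_torus R => expi (- (k%:~R * angle theta)) : R[i]).
Proof.
rewrite (_ : (fun _ => _) = (fun theta => expi ((- k)%:~R * angle theta))).
  exact: cbmeas_angle.
by apply/funext => s; rewrite mulrNz mulNr.
Qed.

Lemma probability_Rintegral_cst (c : R) : \int[mu]_(theta in setT) c = c.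
Proof.
rewrite Rintegral_cst// -[RHS]mulr1; congr (_ * _).
exact: (congr1 fine (probability_setT mu)).
Qed.

Lemma moment0 : moment 0 = 1.
Proof.
rewrite /moment /cint.
under eq_Rintegral do rewrite mul0r oppr0 expi0.
under [X in Complex _ X]eq_Rintegral do rewrite mul0r oppr0 expi0.
by rewrite !probability_Rintegral_cst.
Qed.

Lemma momentN k : moment (- k) = conjc (moment k).
Proof.
rewrite /moment /cint /=; congr Complex.
  by apply: eq_Rintegral => x _; rewrite /= mulrNz mulNr opprK cosN.
have [_ b] := cbmeas_angleN k; rewrite -mulN1r -RintegralZl//; last first.
  exact: (bmeas_integrable _ _ b).
by apply: eq_Rintegral => x _ /=; rewrite mulrNz mulNr opprK sinN mulN1r opprK.
Qed.

Lemma normc_moment k : normc (moment k) <= 2.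
Proof.
have bound (f : borel_torus R -> R) : bmeas setT f -> (forall t, `|f t| <= 1) ->
    `|\int[mu]_(t in setT) f t| <= 1.
  move=> bf f1; apply: (le_trans (le_normr_Rintegral _ _)) => //.
    exact: (bmeas_integrable _ _ bf).
  rewrite -[leRHS]probability_Rintegral_cst; apply: le_Rintegral => //.
    apply: (bmeas_integrable _ _ _) => //; split.
      by apply: measurableT_comp => //; case: bf.
    by exists 1 => x _; rewrite normr_id.
  by apply: (bmeas_integrable _ _ _) => //; exact: bmeas_cst.
have [b1 b2] := cbmeas_angleN k.
apply: (le_trans (normc_le _)); rewrite -[2]/(1 + 1).
apply: lerD; apply: bound => // x.
  exact: cos_max.
exact: sin_max.
Qed.

Lemma cos_recurrence x (n : nat) :
  2 * cos x * cos (n.+1%:R * x) = cos (n.+2%:R * x) + cos (n%:R * x).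
Proof.
have -> : n.+2%:R * x = n.+1%:R * x + x by rewrite -[n.+2%:R]natr1 mulrDl mul1r.
have -> : n%:R * x = n.+1%:R * x - x by rewrite -natr1 mulrDl mul1r addrK.
by rewrite cosD cosB; ring.
Qed.

Variables (m q : R).
Hypotheses (m0 : 0 < m) (q0 : 0 < q) (q12 : q <= 1 / 2).

Let q_lt1 : q < 1.
Proof. by have := q12; lra. Qed.

Definition qcoef k : R[i] := real_complex R (q ^+ `|k|%N).

Lemma poisson_denominator_gt0 x : 0 < 1 - 2 * q * cos x + q ^+ 2.
Proof.
have := cos_le1 x => c1.
have h : 2 * q * cos x <= 2 * q * 1 by rewrite ler_wpM2l// mulr_ge0// ltW.
have h2 : 0 < (1 - q) ^+ 2 by rewrite exprn_gt0// subr_gt0.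
have h3 : (1 - q) ^+ 2 = 1 - 2 * q * 1 + q ^+ 2 by ring.
by move: h h2; rewrite h3; move: (2 * q * cos x) (2 * q * 1) (q ^+ 2) => *; lra.
Qed.

Lemma decays_qcoef : decays qcoef.
Proof.
exists 1, q; split; [exact: ler01|exact: ltW|exact: q_lt1|] => k.
by rewrite /qcoef /= expr0n addr0 sqrtr_sqr mul1r ger0_norm// exprn_ge0// ltW.
Qed.

(** The geometric summation of the Poisson kernel, kept real: multiplying by the
    denominator telescopes the partial sums. *)
Lemma Re_tpoly_qcoef x n :
  complex.Re (tpoly qcoef x n) * (1 - 2 * q * cos x + q ^+ 2) =
  1 - q ^+ 2 + 2 * q ^+ n.+1 * (q * cos (n%:R * x) - cos (n.+1%:R * x)).
Proof.
elim: n => [|n IH].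
  rewrite /tpoly big_ord1 /qcoef /= subrr /= mul0r mul1r cos0 sin0 [1 * x]mul1r.
  by ring.
rewrite /tpoly (symsumS (fun k => qcoef k * expi (k%:~R * x))) -/(tpoly qcoef x n).
rewrite !Re_add [LHS]mulrDl IH /qcoef abszN !Re_realM /= mulrNz mulNr cosN.
rewrite -?pmulrn; have := cos_recurrence x n.
rewrite [q ^+ n.+2]exprS [q ^+ n.+1]exprS.
move: (cos x) (cos (n%:R * x)) (cos (n.+1%:R * x)) (cos (n.+2%:R * x)) (q ^+ n).
move=> c c0 c1 c2 y cE.
transitivity (1 - q * q + 2 * (q * y) * (q * c0 - c1) +
  2 * (q * y) * (c1 - q * (2 * c * c1) + q ^+ 2 * c1)).
  by ring.
by rewrite cE; ring.
Qed.

Lemma poisson_kernelE x : poisson_kernel q x = tser qcoef x.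
Proof.
have cv := @tser_cvg R _ x decays_qcoef.
have d0 := poisson_denominator_gt0 x; set d := 1 - _ + _ in d0.
have cv1 : complex.Re (tpoly qcoef x n) * d @[n --> \oo] --> tser qcoef x * d.
  by apply: cvgM => //; exact: cvg_cst.
have cv2 : complex.Re (tpoly qcoef x n) * d @[n --> \oo] --> 1 - q ^+ 2.
  rewrite (_ : (fun n => _) = fun n => 1 - q ^+ 2 +
      2 * q ^+ n.+1 * (q * cos (n%:R * x) - cos (n.+1%:R * x))); last first.
    by apply/funext => n; exact: Re_tpoly_qcoef.
  rewrite -[X in _ --> X]addr0; apply: cvgD; first exact: cvg_cst.
  (* 4 q^(n + 1) bounds the remainder, as |q cos - cos| <= 2 *)
  have g0 : geometric (4 * q) q n @[n --> \oo] --> 0.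
    by apply: cvg_geometric; rewrite gtr0_norm//; lra.
  have g0N : - geometric (4 * q) q n @[n --> \oo] --> 0.
    by rewrite -oppr0; apply: cvgN.
  apply: (squeeze_cvgr _ g0N g0); apply: nearW => n; rewrite -ler_norml.
  rewrite !normrM (@ger0_norm _ 2)// (ger0_norm (exprn_ge0 _ (ltW q0)))/=.
  have : `|q * cos (n%:R * x) - cos (n.+1%:R * x)| <= 2.
    apply: (le_trans (ler_normB _ _)); rewrite normrM (gtr0_norm q0).
    have := cos_max (n%:R * x); have := cos_max (n.+1%:R * x) => h1 h2.
    have : q * `|cos (n%:R * x)| <= q * 1 by rewrite ler_wpM2l// ltW.
    have := q_lt1; lra.
  rewrite exprS => h; have y0 : 0 <= 2 * (q * q ^+ n).
    by rewrite !mulr_ge0 ?exprn_ge0// ltW.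
  apply: (le_trans (ler_wpM2l y0 h)).
  by rewrite le_eqVlt; apply/orP; left; apply/eqP; ring.
have dE : tser qcoef x * d = 1 - q ^+ 2 by exact: (cvg_unique _ cv1 cv2).
by rewrite /poisson_kernel -/d -dE mulfK// gt_eqF.
Qed.

Definition rho_coef k : R[i] := real_complex R (m * q ^+ `|k|%N) * moment k.

Lemma decays_rho_coef : decays rho_coef.
Proof.
exists (m * 2), q; split; [by rewrite mulr_ge0// ltW|exact: ltW|exact: q_lt1|] => k.
have mq0 : 0 <= m * q ^+ `|k|%N by rewrite mulr_ge0 ?exprn_ge0// ltW.
rewrite normcM /= expr0n addr0 sqrtr_sqr ger0_norm// [leRHS]mulrAC.
by apply: ler_wpM2l => //; exact: normc_moment.
Qed.

Lemma hermitian_rho_coef : hermitian rho_coef.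
Proof.
move=> k; rewrite /rho_coef abszN momentN [RHS]rmorphM; congr (_ * _).
by rewrite /= oppr0.
Qed.

Lemma tpoly_angle s n :
  (fun theta : borel_torus R => tpoly qcoef (s - angle theta) n) =
  fun theta => \sum_(j < n.*2.+1)
    qcoef (j%:Z - n%:Z) * expi ((j%:Z - n%:Z)%:~R * s) *
    expi (- ((j%:Z - n%:Z)%:~R * angle theta)).
Proof.
by apply/funext => theta; apply: eq_bigr => j _; rewrite -mulrA -expiD mulrBr.
Qed.

(** Bounded convergence under the measure, for the partial sums of the kernel. *)
Lemma poisson_kernel_cvg s :
  bmeas setT (fun theta : borel_torus R => poisson_kernel q (s - angle theta)) /\
  \int[mu]_theta complex.Re (tpoly qcoef (s - angle theta) n) @[n --> \oo] -->
    poisson_integral q mu s.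
Proof.
have [K KP] := tpoly_bounded decays_qcoef.
have bt n :
    cbmeas setT (fun theta : borel_torus R => tpoly qcoef (s - angle theta) n).
  rewrite tpoly_angle.
  apply: cbmeas_sum => j; apply: cbmeasM; [exact: cbmeas_cst|exact: cbmeas_angleN].
apply: (@bounded_cvg _ _ R mu setT measurableT muT_fin
  (fun n theta => complex.Re (tpoly qcoef (s - angle theta) n))
  (fun theta => poisson_kernel q (s - angle theta)) K).
- by move=> n; have [[]] := bt n.
- by move=> n x _; apply: le_trans (KP n _); exact: Re_le_normc.
- by move=> theta _; rewrite poisson_kernelE; apply: tser_cvg; exact: decays_qcoef.
Qed.

Lemma poisson_integral_tser s : m * poisson_integral q mu s = tser rho_coef s.
Proof.
have [_ cv] := poisson_kernel_cvg s.
have tm n : m * \int[mu]_theta complex.Re (tpoly qcoef (s - angle theta) n) =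
    complex.Re (tpoly rho_coef s n).
  transitivity (m * complex.Re (cint mu setT (fun theta =>
    tpoly qcoef (s - angle theta) n))).
    by [].
  rewrite tpoly_angle.
  rewrite cint_sum//; last first.
    by move=> j; apply: cbmeasM; [exact: cbmeas_cst|exact: cbmeas_angleN].
  rewrite -Re_realM mulr_sumr; congr complex.Re; apply: eq_bigr => j _.
  rewrite cintZ//; last exact: cbmeas_angleN.
  by rewrite -/(moment _) /rho_coef rmorphM /=; ring.
have cvm : complex.Re (tpoly rho_coef s n) @[n --> \oo] -->
    m * poisson_integral q mu s.
  under eq_fun do rewrite -tm.
  by apply: cvgM => //; exact: cvg_cst.
by apply: (cvg_unique _ cvm) => //; apply: tser_cvg; exact: decays_rho_coef.
Qed.

(** The kernel is bounded below by its value (1 - q^2) / (1 + q)^2 at pi. *)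
Lemma poisson_integral_gt0 s : 0 < poisson_integral q mu s.
Proof.
have q1 := q_lt1; pose c := (1 - q ^+ 2) / (1 + q) ^+ 2.
have num0 : 0 < 1 - q ^+ 2 by rewrite subr_gt0 expr_lt1// ltW.
have den0 : 0 < (1 + q) ^+ 2 by rewrite exprn_gt0// ltr_wpDr// ltW.
have c0 : 0 < c by rewrite divr_gt0.
apply: (lt_le_trans c0); rewrite -[leLHS]probability_Rintegral_cst.
have [bk _] := poisson_kernel_cvg s.
apply: le_Rintegral => //; [|exact: (bmeas_integrable _ _ bk)|].
  by apply: (bmeas_integrable _ _ _) => //; exact: bmeas_cst.
move=> theta _; rewrite /c /poisson_kernel ler_pM2l// lef_pV2 ?posrE//.
  have := cos_geN1 (s - angle theta) => h.
  have : 2 * q * -1 <= 2 * q * cos (s - angle theta).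
    by rewrite ler_wpM2l// mulr_ge0// ltW.
  by rewrite sqrrD; lra.
exact: poisson_denominator_gt0.
Qed.

(** The vector d_(j + 1) of the Hermitian form at theta. *)
Let mode (j : nat) (theta : borel_torus R) : R[i] :=
  moment j.+1 * expi (j.+1%:Z%:~R * angle theta).

Let cbmeas_mode j : cbmeas setT (mode j).
Proof. by apply: cbmeasM; [exact: cbmeas_cst|exact: cbmeas_angle]. Qed.

(** Written with the moment at - (j + 1) and the opposite exponential, which is the
    shape in which it comes out of the coefficients of rho. *)
Let conj_mode (j : nat) (theta : borel_torus R) : R[i] :=
  moment (- j.+1%:Z) * expi (- (j.+1%:Z%:~R * angle theta)).

Let cbmeas_conj_mode j : cbmeas setT (conj_mode j).
Proof. by apply: cbmeasM; [exact: cbmeas_cst|exact: cbmeas_angleN]. Qed.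

Let Re_conj_modeM i j theta : complex.Re (conj_mode i theta * mode j theta) =
  complex.Re (mode i theta) * complex.Re (mode j theta) +
  complex.Im (mode i theta) * complex.Im (mode j theta).
Proof.
have -> : conj_mode i theta = conjc (mode i theta).
  by rewrite /conj_mode /mode momentN [RHS]rmorphM -conj_expi.
by case: (mode i theta) => a b; case: (mode j theta) => c d /=; rewrite mulNr opprK.
Qed.

(** The truncated value of (2 I1 + I2) / (2 pi) supplied by [cubic_form_cvg]. *)
Definition toeplitz_sum n : R := complex.Re (\sum_(i < n) \sum_(j < n)
  real_complex R (2 * i.+1%:R * j.+1%:R * (i.+1%:R + j.+1%:R)) *
  (rho_coef (- i.+1%:Z) * rho_coef j.+1 * rho_coef (i%:Z - j%:Z))).

Let wt (i j : nat) : R :=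
  i.+1%:R * j.+1%:R * (i.+1%:R + j.+1%:R) * q ^+ ((maxn i j).+1.*2).

Let integrand n (theta : borel_torus R) : R[i] := \sum_(i < n) \sum_(j < n)
  real_complex R (2 * m ^+ 3 * wt i j) * (conj_mode i theta * mode j theta).

Let cbmeas_integrand n : cbmeas setT (integrand n).
Proof.
apply: cbmeas_sum => i; apply: cbmeas_sum => j.
apply: cbmeasM; first exact: cbmeas_cst.
by apply: cbmeasM; [exact: cbmeas_conj_mode|exact: cbmeas_mode].
Qed.

(** The factor q of the coefficients of frequencies - (i + 1), j + 1 and i - j
    appears to the power i + 1 + j + 1 + |i - j| = 2 max (i + 1, j + 1), which is
    separate from the measure; and the moment at i - j is the integral of
    exp (- i (i - j) theta), which splits the form into an average over theta of
    Hermitian forms. *)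
Let toeplitz_sumE n : toeplitz_sum n = \int[mu]_theta complex.Re (integrand n theta).
Proof.
transitivity (complex.Re (cint mu setT (integrand n))); last by [].
have bij (i j : nat) : cbmeas setT (fun theta =>
    real_complex R (2 * m ^+ 3 * wt i j) * (conj_mode i theta * mode j theta)).
  apply: cbmeasM; first exact: cbmeas_cst.
  by apply: cbmeasM; [exact: cbmeas_conj_mode|exact: cbmeas_mode].
rewrite /integrand cint_sum//; last by move=> i; apply: cbmeas_sum => j; exact: bij.
congr complex.Re; apply: eq_bigr => i _.
rewrite cint_sum//; apply: eq_bigr => j _.
pose z : R[i] := real_complex R (2 * m ^+ 3 * wt i j) *
  (moment (- i.+1%:Z) * moment j.+1).
have -> : (fun theta => real_complex R (2 * m ^+ 3 * wt i j) *
      (conj_mode i theta * mode j theta)) =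
    (fun theta => z * expi (- ((i%:Z - j%:Z)%:~R * angle theta))).
  apply/funext => theta; rewrite /z /conj_mode /mode.
  have -> : - ((i%:Z - j%:Z)%:~R * angle theta) =
      - (i.+1%:Z%:~R * angle theta) + j.+1%:Z%:~R * angle theta.
    rewrite -!mulNr -mulrDl; congr (_ * _).
    by rewrite -!mulrNz -intrD; congr (_%:~R); lia.
  by rewrite expiD; ring.
rewrite cintZ//; last exact: cbmeas_angleN.
rewrite -/(moment _) /z /rho_coef abszN !absz_nat /wt.
have <- : (i.+1 + j.+1 + `|(i%:Z - j%:Z)%R| = (maxn i j).+1.*2)%N by lia.
by rewrite !exprD !rmorphM /= !rmorphXn /=; ring.
Qed.

(** The real and imaginary parts of the modes decouple since the weights are real
    and symmetric. *)
Lemma toeplitz_sum_ge n l (c : R) : (l < n)%N ->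
  (forall theta : borel_torus R,
    c <= (\sum_(i < l.+1) i.+1%:R * complex.Re (mode i theta)) ^+ 2 +
         (\sum_(i < l.+1) i.+1%:R * complex.Im (mode i theta)) ^+ 2) ->
  2 * m ^+ 3 * ((lin_weight q l - lin_weight q l.+1) * c) <= toeplitz_sum n.
Proof.
move=> ln cP; rewrite toeplitz_sumE -[leLHS]probability_Rintegral_cst.
have [bF _] := cbmeas_integrand n.
apply: le_Rintegral => //; [|exact: (bmeas_integrable _ _ bF)|].
  by apply: (bmeas_integrable _ _ _) => //; exact: bmeas_cst.
move=> theta _.
have -> : complex.Re (integrand n theta) = 2 * m ^+ 3 *
    (\sum_(i < n) \sum_(j < n) wt i j *
       (complex.Re (mode i theta) * complex.Re (mode j theta)) +
     \sum_(i < n) \sum_(j < n) wt i j *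
       (complex.Im (mode i theta) * complex.Im (mode j theta))).
  rewrite /integrand -big_split mulr_sumr Re_sum; apply: eq_bigr => i _ /=.
  rewrite -big_split mulr_sumr Re_sum; apply: eq_bigr => j _.
  by rewrite Re_realM Re_conj_modeM /= -mulrDr mulrA.
apply: ler_wpM2l; first by rewrite mulr_ge0// exprn_ge0// ltW.
have d0 : 0 <= lin_weight q l - lin_weight q l.+1.
  by rewrite subr_ge0 ltW// lin_weight_lt.
apply: (le_trans (ler_wpM2l d0 (cP theta))); rewrite mulrDr.
apply: lerD.
  exact: (weighted_form_ge q0 q12 (fun i => complex.Re (mode i theta)) ln).
exact: (weighted_form_ge q0 q12 (fun i => complex.Im (mode i theta)) ln).
Qed.

Lemma toeplitz_sum_ge0 n : 0 <= toeplitz_sum n.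
Proof.
case: n => [|n]; first by rewrite /toeplitz_sum big_ord0.
have := @toeplitz_sum_ge n.+1 0 0 (ltn0Sn _); rewrite !mulr0; apply => theta.
by rewrite addr_ge0 ?sqr_ge0.
Qed.

(** At the first nonvanishing moment the partial sum in [weighted_form_ge] reduces
    to one mode, whose modulus does not depend on theta. This gives a positive
    lower bound that is uniform in the cutoff, hence survives the limit. *)
Lemma toeplitz_sum_gt0 : (exists l, moment l.+1 != 0) -> exists l (c : R), 0 < c /\
  forall n, (l < n)%N -> c <= toeplitz_sum n.
Proof.
move=> ex; case: (ex_minnP ex) => l ml0 lmin.
have m0l i : (i < l)%N -> moment i.+1 = 0.
  by move=> il; apply/eqP/negPn/negP => /lmin; rewrite leqNgt il.
pose c := (l.+1%:R * normc (moment l.+1)) ^+ 2.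
exists l, (2 * m ^+ 3 * ((lin_weight q l - lin_weight q l.+1) * c)); split.
  have nm : 0 < normc (moment l.+1).
    by rewrite lt_def normc_ge0 andbT; apply: contra ml0 => /eqP/eq0_normc ->.
  rewrite !mulr_gt0 ?exprn_gt0 ?mulr_gt0//.
  by rewrite subr_gt0 lin_weight_lt.
move=> n ln; apply: toeplitz_sum_ge => // theta.
have mode0 (i : 'I_l) : mode i theta = 0 by rewrite /mode m0l// mul0r.
have lastE (f : nat -> R) : (forall i : 'I_l, f i = 0) ->
    \sum_(i < l.+1) i.+1%:R * f i = l.+1%:R * f l.
  by move=> f0; rewrite big_ord_recr/= big1 ?add0r// => i _; rewrite f0 mulr0.
rewrite (lastE (fun i => complex.Re (mode i theta))) => [|i]; last by rewrite mode0.
rewrite (lastE (fun i => complex.Im (mode i theta))) => [|i]; last by rewrite mode0.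
rewrite !exprMn -mulrDr /c exprMn; apply: ler_wpM2l; first exact: sqr_ge0.
have -> : normc (moment l.+1) = normc (mode l theta).
  by rewrite /mode normcM normc_expi mulr1.
by case: (mode l theta) => a b /=; rewrite sqr_sqrtr// addr_ge0 ?sqr_ge0.
Qed.

Lemma tser_rho_coef_cst : (forall l, moment l.+1 = 0) ->
  forall s, tser rho_coef s = m.
Proof.
move=> m00 s; have cv := @tser_cvg R _ s decays_rho_coef.
apply: (cvg_unique _ cv) => //.
rewrite (_ : (fun n => _) = cst m); first exact: cvg_cst.
apply/funext => n; elim: n => [|n IH].
  rewrite /tpoly big_ord1 subrr mul0r expi0 mulr1.
  by rewrite /rho_coef moment0 mulr1 expr0 mulr1.
rewrite /tpoly (symsumS (fun k => rho_coef k * expi (k%:~R * s))).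
rewrite -/(tpoly rho_coef s n).
by rewrite Re_add IH /rho_coef momentN m00 conjc0 !mulr0 !mul0r addr0 /= addr0.
Qed.

Lemma tser_periodic u : periodic (tser u) (2 * pi).
Proof.
move=> s; rewrite /tser; congr (limn _); apply/funext => n; congr complex.Re.
by apply: eq_bigr => j _; rewrite mulrDr expi_period.
Qed.

End torus_moments.

(** * The inequality *)

Theorem corollary3p53 (R : realType) (mu : probability (borel_torus R) R)
    (m q : R) (rho : R -> R)
    (m_gt0 : 0 < m) (q_gt0 : 0 < q) (q_le_half : q <= 1 / 2)
    (rhoE : forall s : R, rho s = m * poisson_integral q mu s) :
  [/\ smooth_on_torus rho,
      forall s : R, 0 < rho s,
      0 <= 2 * I1 rho + I2 rho &
      ~ (exists c : R, forall s : R, rho s = c) -> 0 < 2 * I1 rho + I2 rho].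
Proof.
have du := decays_rho_coef mu m_gt0 q_gt0 q_le_half.
have hu := hermitian_rho_coef mu m q.
have rE : rho = tser (rho_coef mu m q).
  by apply/funext => s; rewrite rhoE poisson_integral_tser.
have pi2 : 0 < 2 * pi :> R by rewrite mulr_gt0// pi_gt0.
have cv : 2 * pi * toeplitz_sum mu m q n @[n --> \oo] --> 2 * I1 rho + I2 rho.
  by rewrite rE; exact: cubic_form_cvg.
have lim_ge c l : (forall n, (l < n)%N -> c <= toeplitz_sum mu m q n) ->
    2 * pi * c <= 2 * I1 rho + I2 rho.
  move=> cl; rewrite -(cvg_lim (@Rhausdorff R) cv); apply: limr_ge.
    by apply/cvg_ex; eexists; exact: cv.
  by near=> n; rewrite ler_pM2l//; apply: cl; near: n; exact: nbhs_infty_gt.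
split.
- rewrite rE; split; first exact: tser_periodic.
  by move=> n s; exact: tser_smooth.
- by move=> s; rewrite rhoE mulr_gt0// poisson_integral_gt0.
- rewrite -[leLHS](mulr0 (2 * pi)); apply: (@lim_ge 0 0) => n _.
  exact: toeplitz_sum_ge0.
- move=> ncst.
  have [|l [c [c0 cP]]] := @toeplitz_sum_gt0 _ mu m q m_gt0 q_gt0 q_le_half.
    apply: contrapT => nex; apply: ncst; exists m => s; rewrite rE.
    apply: tser_rho_coef_cst => // l; apply/eqP/negPn/negP => ml.
    by apply: nex; exists l.
  by apply: lt_le_trans (lim_ge _ _ cP); rewrite mulr_gt0.
Unshelve. all: by end_near. Qed.
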